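(* Let $k\le n$ and $s$ be positive integers and let $\lambda$ be a partition of $k$ with at most $s$ parts. Then $$D_{n,\lambda,s}=\sum_{\varphi\in\mathrm{SECI}_{n,\lambda,s}}q^{\mathrm{inv}(\varphi)}F_{n,\mathrm{iDes}(\mathrm{rw}(\varphi))}(\mathbf{x})=\sum_{\varphi\in\mathrm{SECI}_{n,\lambda,s}}q^{\mathrm{dinv}(\varphi)}F_{n,\mathrm{iDes}(\mathrm{rw}(\varphi))}(\mathbf{x}).$$
   Context: A partition $\lambda=(\lambda_1\ge\dots\ge\lambda_{\ell(\lambda)}>0)$ has length $\ell(\lambda)$; set $\lambda_i=0$ for $i>\ell(\lambda)$. Let $\mathbf{x}=(x_1,x_2,\dots)$. Extended column-increasing fillings. Cells are pairs $(i,j)$ with $i$ the column (numbered from the left) and $j$ the row (numbered upward). Let $\mathrm{dg}'(\lambda)=\{(i,j):1\le i\le s,\ 1\le j\le\lambda_i\}$. An element $\varphi\in\mathrm{ECI}_{n,\lambda,s}$ consists of a set of basement cells $B(\varphi)=\{(i,j):1\le i\le s,\ -b_i<j\le0\}$ for some nonnegative integers $b_1,\dots,b_s$, such that $D(\varphi)=\mathrm{dg}'(\lambda)\cup B(\varphi)$ has exactly $n$ cells, together with a labeling $(i,j)\mapsto\varphi_{i,j}$ of $D(\varphi)$ by positive integers that weakly increases down each column ($\varphi_{i,j}\le\varphi_{i,j'}$ if $j>j'$). $\mathrm{SECI}_{n,\lambda,s}$ is the subset of those $\varphi$ whose labels are $1,\dots,n$, each used exactly once. Put $\mathbf{x}^\varphi=\prod_{i\ge1}x_i^{\#\{i\text{'s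 in }\varphi\}}$. The reading word $\mathrm{rw}(\varphi)$ lists the labels of $D(\varphi)$ row by row from the top row to the bottom row, left to right within each row; for $\varphi\in\mathrm{SECI}_{n,\lambda,s}$ it is a permutation in $S_n$ in one-line notation. $\mathrm{inv}(\varphi)$ is the total number of the following: (I1) pairs $((i,j),(i',j'))$ of cells of $\mathrm{dg}'(\lambda)$ with $\varphi_{i,j}>\varphi_{i',j'}$ and either $j=j'$, $i<i'$, or $j=j'+1$, $i>i'$; (I2) pairs $((i,1),(i',j'))$ with $(i,1)\in\mathrm{dg}'(\lambda)$, $(i',j')\in B(\varphi)$, $i>i'$ and $\varphi_{i,1}>\varphi_{i',j'}$; (I3) pairs $(i,(i',j'))$ with $(i',j')\in B(\varphi)$ and $i$ an integer with $1\le i<i'$. A $\lambda$-attacking pair is a pair of coordinates $((i,j),(i',j'))$ with $1\le i,i'\le s$, $j\le\lambda_i$, $j'\le\lambda_{i'}$ ($j,j'$ any integers) such that either $j=j'$ and $i<i'$, or $j=j'+1$ and $i>i'$. $\mathrm{dinv}(\varphi)$ is the number of $\lambda$-attacking pairs $((i,j),(i',j'))$ such that either (D1) both $(i,j),(i',j')\in D(\varphi)$ and $\varphi_{i,j}>\varphi_{i',j'}$, or (D2) $j,j'\le0$, $(i,j)\notin D(\varphi)$ and $(i',j')\in D(\varphi)$. $D_{n,\lambda,s}$ denotes the common value of the two generating functions $\sum_{\varphi\in\mathrm{ECI}_{n,\lambda,s}}q^{\mathrm{inv}(\varphi)}\mathbf{x}^\varphi=\sum_{\varphi\in\mathrm{ECI}_{n,\lambda,s}}q^{\mathrm{dinv}(\varphi)}\mathbf{x}^\varphi$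 (which are equal). For $\pi\in S_n$, $\mathrm{Des}(\pi)=\{i:1\le i\le n-1,\ \pi_i>\pi_{i+1}\}$ and $\mathrm{iDes}(\pi)=\mathrm{Des}(\pi^{-1})$. For $D\subseteq[n-1]$, Gessel's fundamental quasisymmetric function is $F_{n,D}(\mathbf{x})=\sum x_{a_1}\cdots x_{a_n}$ over all positive integer sequences $a_1\le\dots\le a_n$ with $a_i<a_{i+1}$ for all $i\in D$. *)

(* Defs.v *)
From mathcomp Require Export all_boot all_order all_algebra.
From mathcomp Require Export finmap multiset.
From mathcomp Require Export boolp classical_sets functions cardinality fsbigop.

Set Implicit Arguments.
Unset Strict Implicit.
Unset Printing Implicit Defensive.

Import Order.TTheory GRing.Theory Num.Theory.

Local Open Scope classical_set_scope.
Local Open Scope fset_scope.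
Local Open Scope fmap_scope.
Local Open Scope ring_scope.

(* A monomial in x_1, x_2, ... is the multiset of the indices of its variables,
   so that m i is the exponent of x_i. A formal power series in these variables
   over Z[q] is its coefficient function; q is 'X. Indices and labels are
   natural numbers required to be positive, so x_0 never occurs. *)
Definition monomial := {mset nat}%mset.
Definition pseries := monomial -> {poly int}.

(* The formal sum of the terms w t * mon t for t in A. It is meaningful for
   families with finitely many terms on each monomial; that is the case below,
   where the degree is fixed and the labels are bounded by those occurring in
   the monomial. *)
Definition formal_sum (T : choiceType) (A : set T)
    (w : T -> {poly int}) (mon : T -> monomial) : pseries :=
  fun m => \sum_(t \in [set t | A t /\ mon t = m]) w t.

(* Partitions are lists of their nonzero parts; the i-th part (i >= 1) is 0
   beyond the length. *)
Definition is_partition_of (k : nat) (la : seq nat) : bool :=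
  [&& sorted geq la, 0%N \notin la & sumn la == k].

Definition part (la : seq nat) (i : nat) : nat := nth 0%N la i.-1.

(* (column, row), columns numbered from 1 *)
Notation cell := (nat * int)%type.

Definition dg (la : seq nat) (s : nat) : {fset cell} :=
  [fset (i, j%:Z) | i in iota 1 s, j in iota 1 (part la i)].

Definition basement (b : nat -> nat) (s : nat) : {fset cell} :=
  [fset (i, - j%:Z) | i in iota 1 s, j in iota 0 (b i)].

(* A filling maps the cells of its diagram D(phi) = domf phi to labels. *)
Notation filling := {fmap cell -> nat}.

(* Only used at cells of D(phi); the default 0 is irrelevant. *)
Definition label (phi : filling) (c : cell) : nat := odflt 0%N phi.[? c].

Definition labels (phi : filling) : seq nat :=
  [seq label phi c | c <- enum_fset (domf phi)].

Definition base (phi : filling) : {fset cell} :=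
  [fset c in domf phi | c.2 <= 0].

Definition ECI (n : nat) (la : seq nat) (s : nat) : set filling :=
  [set phi : filling |
    [/\ exists b : nat -> nat, domf phi = dg la s `|` basement b s,
        #|` domf phi| = n,
        {in domf phi, forall c, (0 < label phi c)%N} &
        {in domf phi &, forall c c',
           c.1 = c'.1 -> c'.2 < c.2 -> (label phi c <= label phi c')%N}]].

Definition SECI (n : nat) (la : seq nat) (s : nat) : set filling :=
  [set phi : filling | ECI n la s phi /\ perm_eq (labels phi) (iota 1 n)].

Definition xmon (phi : filling) : monomial := seq_mset (labels phi).

(* Reading order on cells: top row first, left to right in each row. *)
Definition reading (c c' : cell) : bool :=
  (c'.2 < c.2) || (c.2 == c'.2) && (c.1 <= c'.1)%N.

Definition rw (phi : filling) : seq nat :=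
  [seq label phi c | c <- sort reading (enum_fset (domf phi))].

Definition attacks (c c' : cell) : bool :=
  (c.2 == c'.2) && (c.1 < c'.1)%N || (c.2 == c'.2 + 1) && (c'.1 < c.1)%N.

Definition inv1 (la : seq nat) (s : nat) (phi : filling) : nat :=
  #|` [fset p in dg la s `*` dg la s |
        attacks p.1 p.2 && (label phi p.2 < label phi p.1)%N]|.

Definition inv2 (la : seq nat) (s : nat) (phi : filling) : nat :=
  #|` [fset p in dg la s `*` base phi |
        [&& p.1.2 == 1, (p.2.1 < p.1.1)%N &
            (label phi p.2 < label phi p.1)%N]]|.

(* The bound i <= s is implied by i < i'. *)
Definition inv3 (s : nat) (phi : filling) : nat :=
  #|` [fset p in [fset i in iota 1 s] `*` base phi | (p.1 < p.2.1)%N]|.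

Definition inv (la : seq nat) (s : nat) (phi : filling) : nat :=
  (inv1 la s phi + inv2 la s phi + inv3 s phi)%N.

(* Coordinates need not be cells of a filling: rows are unbounded below. *)
Definition coordinate (la : seq nat) (s : nat) (c : cell) : bool :=
  (1 <= c.1 <= s)%N && (c.2 <= (part la c.1)%:Z).

Definition attacking_pair (la : seq nat) (s : nat) (c c' : cell) : bool :=
  [&& coordinate la s c, coordinate la s c' & attacks c c'].

(* The set is finite: c' lies in D(phi), and c in its row or the one above. *)
Definition dinv (la : seq nat) (s : nat) (phi : filling) : nat :=
  #|` fset_set [set p : cell * cell |
        attacking_pair la s p.1 p.2 /\
        ([/\ p.1 \in domf phi, p.2 \in domf phi &
             (label phi p.2 < label phi p.1)%N] \/
         [/\ p.1.2 <= 0, p.2.2 <= 0, p.1 \notin domf phi &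
             p.2 \in domf phi])]|.

(* Permutations of 1, ..., n in one-line notation; w_i is nth 0 w i.-1. *)
Definition Des (w : seq nat) : {fset nat} :=
  [fset i in iota 1 (size w).-1 | (nth 0%N w i < nth 0%N w i.-1)%N].

Definition inverse_word (w : seq nat) : seq nat :=
  [seq (index v w).+1 | v <- iota 1 (size w)].

Definition iDes (w : seq nat) : {fset nat} := Des (inverse_word w).

Definition gessel_F (n : nat) (D : {fset nat}) : pseries :=
  formal_sum
    [set a : n.-tuple nat |
      [/\ all (fun i => 0 < i)%N a, sorted leq a &
          {in D, forall i, (nth 0%N a i.-1 < nth 0%N a i)%N}]]
    (fun=> 1) (fun a => seq_mset a).

Definition ECI_series (n : nat) (la : seq nat) (s : nat)
    (stat : filling -> nat) : pseries :=
  formal_sum (ECI n la s) (fun phi => 'X^(stat phi)) xmon.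

(* SECI n la s is finite. *)
Definition SECI_F_series (n : nat) (la : seq nat) (s : nat)
    (stat : filling -> nat) : pseries :=
  fun m => \sum_(phi \in SECI n la s)
             'X^(stat phi) * gessel_F n (iDes (rw phi)) m.

(* D_{n,la,s} is the common value of the inv and the dinv series. *)
Definition Dseries (n : nat) (la : seq nat) (s : nat) : pseries :=
  ECI_series n la s (inv la s).

(* Main.v *)
Require Import Defs.
From mathcomp Require Import zify.

(** Fill a diagram one cell at a time, in increasing order of the labels. Since
    labels increase down the columns, each new cell is the highest empty cell of
    its column, so a filling is encoded by the word of the columns of its
    successive cells, together with its sorted sequence [a] of labels. In this
    encoding every sum of the theorem becomes a sum over words of length [n] in
    the letters [1, ..., s] in which each column [i] occurs at least [la_i]
    times.

    Let [h i] be the highest empty row of column [i] at some stage, and order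
    the columns by decreasing [h i] and then from left to right. The cells that
    attack a new cell and are still empty when it is filled are counted by the
    rank of its column in this order; thus dinv is the sum of the ranks of the
    letters of the word ([dinv_fill]). The statistic inv is the sum of the ranks
    computed with [max (h i) 0] in place of [h i] ([inv_fill]).

    A filling with repeated labels comes from several words. The one that lists
    the cells of equal labels in reading order is selected
    ([sum_fillings_words]); its standard filling is the standardization of the
    filling. The same condition on the word says that [a] is one of the
    sequences summed in the fundamental quasisymmetric function of the standard
    filling of the word ([strict_iDes_rw]). The quasisymmetric expansion follows
    for both statistics, because each of them depends on the word only.

    To compare inv with dinv, cells of equal labels are listed, for inv, in the
    reading order in which all basement rows are identified. In both cases the
    order condition then says that the ranks increase weakly along equal labels
    ([leq_rank_step]), so it is a condition on the sequence of ranks. At each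
    stage the rank is a bijection from the columns to [0, ..., s-1]. Exchanging
    the column of a given rank in the dinv order for the column of the same rank
    in the inv order matches the words with equal sequences of ranks: the two
    choices agree while they fill a positive row, and basement cells do not
    affect [max (h i) 0]. Hence the two generating functions are equal
    ([sum_words_trunc]). *)

Set Implicit Arguments.
Unset Strict Implicit.
Unset Printing Implicit Defensive.

Import Order.TTheory GRing.Theory Num.Theory.

Local Open Scope ring_scope.

(** * Words in the columns and the cells they fill *)

(** A state [h] gives, for each column [i], the highest row [h i] of the column
    that is still empty. Filling that cell lowers [h i] by one. *)
Definition decr (h : nat -> int) (i : nat) : nat -> int :=
  fun x => h x - (x == i)%:Z.

(** The cells filled, in order, when the letters of the column word [u] are read
    from the state [h]: each letter [i] fills the highest empty cell of column
    [i]. *)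
Fixpoint cells (h : nat -> int) (u : seq nat) : seq cell :=
  if u is i :: u' then (i, h i) :: cells (decr h i) u' else [::].

(** The state reached from [h] after reading the word [u]. *)
Definition free_row (h : nat -> int) (u : seq nat) : nat -> int :=
  fun x => h x - (count_mem x u)%:Z.

(** Columns are ranked by their highest empty row, higher rows first and, within
    a row, from left to right. For [i != i'], [before g i i'] also says that
    the cell of column [i] attacking the highest empty cell of column [i'] is
    itself empty. *)
Definition before (g : nat -> int) (i i' : nat) : bool :=
  (i < i')%N && (g i' <= g i) || (i' < i)%N && (g i' < g i).

(** The number of columns, among [1, ..., s], that precede [i'] in the state
    [g]. *)
Definition rank (s : nat) (g : nat -> int) (i' : nat) : nat :=
  count (before g ^~ i') (iota 1 s).

(** The successive ranks of the letters of [u]. The map [rho] acts on rows: it is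
    the identity for dinv and the truncation at row 0 for inv. *)
Fixpoint weights (rho : int -> int) (s : nat) (h : nat -> int) (u : seq nat) :=
  if u is i :: u' then rank s (rho \o h) i :: weights rho s (decr h i) u'
  else [::].

Lemma size_cells h u : size (cells h u) = size u.
Proof. by elim: u h => //= i u IH h; rewrite IH. Qed.

Lemma size_weights rho s h u : size (weights rho s h u) = size u.
Proof. by elim: u h => //= i u IH h; rewrite IH. Qed.

Lemma free_row_cons h i u : free_row (decr h i) u =1 free_row h (i :: u).
Proof. move=> x; rewrite /free_row /decr /= eq_sym; lia. Qed.

Lemma map_fst_cells h u : map fst (cells h u) = u.
Proof. by elim: u h => //= i u IH h; rewrite IH. Qed.

Lemma mem_cells h u c :
  (c \in cells h u) = (free_row h u c.1 < c.2) && (c.2 <= h c.1).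
Proof.
elim: u h c => [|i u IH] h c /=; first by rewrite /free_row in_nil /=; lia.
rewrite inE IH free_row_cons /decr /free_row /= [i == _]eq_sym.
case: c => x y; rewrite xpair_eqE /=; case: eqP => [->|_] /=; lia.
Qed.

Lemma take_cells h u t : take t (cells h u) = cells h (take t u).
Proof. by elim: u h t => [|i u IH] h [|t] //=; rewrite IH. Qed.

Lemma nth_cells h u t : (t < size u)%N ->
  nth (0%N, 0) (cells h u) t =
    (nth 0%N u t, free_row h (take t u) (nth 0%N u t)).
Proof.
elim: u h t => [|i u IH] h [|t] //= lt_t; first by rewrite /free_row /= subr0.
by rewrite IH // free_row_cons.
Qed.

Lemma eq_rank s g g' i : g =1 g' -> rank s g i = rank s g' i.
Proof. by move=> e; apply: eq_count => x; rewrite /before !e. Qed.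

Lemma nth_weights rho s h u t : (t < size u)%N ->
  nth 0%N (weights rho s h u) t =
    rank s (rho \o free_row h (take t u)) (nth 0%N u t).
Proof.
elim: u h t => [|i u IH] h [|t] //= lt_t.
  by apply: eq_rank => x /=; rewrite /free_row /= subr0.
by rewrite IH //; apply: eq_rank => x /=; rewrite free_row_cons.
Qed.

Lemma cells_pairwise h u :
  pairwise (fun c c' => (c.1 == c'.1) ==> (c'.2 < c.2)) (cells h u).
Proof.
elim: u h => //= i u IH h; rewrite IH andbT; apply/allP=> c.
rewrite mem_cells /decr => /andP[_ hc]; apply/implyP=> /eqP /= e.
by move: hc; rewrite e eqxx /=; lia.
Qed.

Lemma cells_uniq h u : uniq (cells h u).
Proof.
rewrite uniq_pairwise; apply: sub_pairwise (cells_pairwise h u) => c c' /=.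
by move=> H; apply/eqP=> e; move: H; rewrite e eqxx ltxx.
Qed.

(** A list of cells whose columns are filled from top to bottom without gaps is
    the list of cells of its word of columns. *)
Lemma cells_of_columns h (cs : seq cell) :
    (forall i, [seq c <- cs | c.1 == i] =
       [seq (i, h i - j%:Z) | j <- iota 0 (count_mem i (map fst cs))]) ->
  cells h (map fst cs) = cs.
Proof.
elim: cs h => //= -[i j] cs IH h H; have := H i; rewrite /= eqxx /= subr0.
case=> -> _; congr cons; apply: IH => x; have := H x.
rewrite /= /decr [x == i]eq_sym; case: eqP => [->|_] /=; last by rewrite subr0.
case=> _ ->; rewrite (iotaDl 1 0) -map_comp.
by apply: eq_map => y /=; congr pair; lia.
Qed.

(** * Ranks of columns *)

Lemma rank_lt_of_before s g g' i i' :
    (1 <= i <= s)%N -> before g' i i' ->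
    (forall x, before g x i -> before g' x i') ->
  (rank s g i < rank s g' i')%N.
Proof.
move=> i_s bi sub; rewrite /rank.
have := count_predUI (before g ^~ i) (pred1 i) (iota 1 s).
rewrite (@eq_count _ (predI _ _) pred0); last first.
  by move=> x /=; case: eqP => [->|]; rewrite ?andbF // /before ltnn.
rewrite count_pred0 (count_uniq_mem _ (iota_uniq _ _)) mem_iota.
have -> : (1 <= i < 1 + s)%N by lia.
rewrite addn0 addn1 => <-; apply: sub_count => x /= /orP[/sub //|/eqP->//].
Qed.

Lemma before_trans g : transitive (before g).
Proof.
rewrite /before => y x z; case: (eqVneq x z) => [->|]; first lia.
by move: (g x) (g y) (g z) => a b c; lia.
Qed.

Lemma before_total g i i' : i != i' -> before g i i' || before g i' i.
Proof. rewrite /before; lia. Qed.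

Lemma rank_inj s g : {in iota 1 s &, injective (rank s g)}.
Proof.
move=> i i'; rewrite !mem_iota => hi hi' e; apply/eqP/negP=> /negP ne.
case/orP: (before_total g ne) => b.
- have /rank_lt_of_before : before g i i' by [].
  move=> /(_ s g); rewrite e ltnn => H; apply: (notF (H _ _)); first lia.
  by move=> x bx; apply: before_trans bx b.
- have /rank_lt_of_before : before g i' i by [].
  move=> /(_ s g); rewrite e ltnn => H; apply: (notF (H _ _)); first lia.
  by move=> x bx; apply: before_trans bx b.
Qed.

Lemma rank_ltn s g i : (1 <= i <= s)%N -> (rank s g i < s)%N.
Proof.
move=> hi; rewrite /rank -[X in (_ < X)%N](size_iota 1 s).
rewrite ltn_neqAle count_size andbT -all_count; apply/negP=> /allP/(_ i).
rewrite mem_iota /before ltnn /= => H.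
suff: false by []. apply: H; lia.
Qed.

Lemma perm_rank s g : perm_eq (map (rank s g) (iota 1 s)) (iota 0 s).
Proof.
have u : uniq (map (rank s g) (iota 1 s)).
  by rewrite map_inj_in_uniq ?iota_uniq //; apply: rank_inj.
apply: uniq_perm; rewrite ?iota_uniq //.
apply: (uniq_min_size u _ _).2; last by rewrite size_map !size_iota.
by move=> x /mapP[i]; rewrite !mem_iota => hi ->; have := @rank_ltn s g i; lia.
Qed.

(** The weights of two consecutive letters increase weakly exactly when the
    second cell does not precede the first in reading order. Here [g] and [g']
    are the states before and after a cell of column [i] is filled: the columns
    preceding [i] keep their rank, those following it lose at most one, and the
    rank of [i] does not decrease. *)
Lemma leq_rank_step s g g' i i' :
    (1 <= i <= s)%N -> (1 <= i' <= s)%N ->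
    (forall x, x != i -> g' x = g x) -> g' i <= g i ->
  (rank s g i <= rank s g' i')%N = reading (i, g i) (i', g' i').
Proof.
move=> hi hi' eg le_g; rewrite /reading /=.
have gx x : g' x = if x == i then g' i else g x.
  by case: eqP => [->|/eqP/eg].
have [e|ne] := eqVneq i' i.
  rewrite e leqnn andbT; have -> : (g' i < g i) || (g i == g' i) by lia.
  by apply: sub_count => x; rewrite /before (gx x); case: (x =P i) => [->|_] /=; lia.
rewrite (eg _ ne); have [b|nb] := boolP (before g i i').
  have -> : (g i' < g i) || (g i == g i') && (i <= i')%N.
    by move: b ne; rewrite /before; lia.
  apply: sub_count => x bx; have := before_trans bx b.
  rewrite {2}/before (eg _ ne) (gx x); case: (x =P i) => [e|_] // _.
  by move: bx; rewrite e /before ltnn.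
have b : before g i' i by move: nb ne; rewrite /before; lia.
have -> : (g i' < g i) || (g i == g i') && (i <= i')%N = false.
  by move: nb ne; rewrite /before; lia.
rewrite leqNgt; apply/negbTE; rewrite negbK; apply: rank_lt_of_before => //.
move=> x; rewrite {1}/before (eg _ ne) (gx x) => bx; apply: before_trans b.
move: bx nb; rewrite /before; case: (x =P i) => [->|_]; lia.
Qed.

(** * Equidistribution of the two kinds of weights *)

(** Identifies all basement rows with row 0. *)
Definition trunc (j : int) : int := Num.max j 0.

(** All words of length [n] in the letters [1, ..., s]. *)
Fixpoint words (s n : nat) : seq (seq nat) :=
  if n is n'.+1 then [seq i :: u | i <- iota 1 s, u <- words s n']
  else [:: [::]].

(** Reading [u] from the state [h] fills all cells in positive rows. *)
Definition covers (s : nat) (h : nat -> int) (u : seq nat) : bool :=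
  all (fun i => free_row h u i <= 0) (iota 1 s).

(** For pairs (label, weight): equal labels have weakly increasing weights. *)
Definition tie (p p' : nat * nat) : bool := (p.1 == p'.1) ==> (p.2 <= p'.2)%N.

Lemma mem_words s n u :
  (u \in words s n) = (size u == n) && all (mem (iota 1 s)) u.
Proof.
elim: n u => [|n IH] [|i u]; rewrite ?inE //.
  by apply/negbTE/negP => /allpairsP[[x v] []].
rewrite /= eqSS andbCA -IH; apply/allpairsP/andP => [[[x v] /= [hx hv [-> ->]]] | []].
  by [].
by move=> hi hu; exists (i, u).
Qed.

Lemma words_uniq s n : uniq (words s n).
Proof.
elim: n => //= n IH; rewrite allpairs_uniq ?iota_uniq //.
by move=> [x v] [y w] /= _ _ [-> ->].
Qed.

Lemma sum_wordsS (R : nmodType) s n (P : pred (seq nat)) (F : seq nat -> R) :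
  \sum_(u <- words s n.+1 | P u) F u =
  \sum_(i <- iota 1 s) \sum_(u <- words s n | P (i :: u)) F (i :: u).
Proof.
rewrite big_mkcond [words s _]/= big_allpairs_dep; apply: eq_bigr => i _.
by rewrite -big_mkcond.
Qed.

(** The column of rank [w] in the state [g], for [w < s]. *)
Definition unrank s g w : nat :=
  nth 0%N (iota 1 s) (index w (map (rank s g) (iota 1 s))).

Lemma unrankP s g w : (w < s)%N ->
  (1 <= unrank s g w <= s)%N /\ rank s g (unrank s g w) = w.
Proof.
move=> lt_ws; have w_in : w \in map (rank s g) (iota 1 s).
  by rewrite (perm_mem (perm_rank s g)) mem_iota.
have := w_in; rewrite -index_mem size_map => lt_i; split.
  have : unrank s g w \in iota 1 s by exact: mem_nth.
  by rewrite mem_iota; lia.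
by rewrite /unrank -(nth_map 0%N 0%N) // nth_index.
Qed.

Lemma sum_rank (R : nmodType) s g (F : nat -> R) :
  \sum_(i <- iota 1 s) F i = \sum_(w <- iota 0 s) F (unrank s g w).
Proof.
rewrite -(perm_big _ (perm_rank s g)) /= big_map; apply: eq_big_seq => i hi.
congr F; apply: (@rank_inj s g) => //.
- rewrite !mem_iota in hi *.
  by have := @rank_ltn s g i; have := @unrankP s g (rank s g i); lia.
- have [] // := @unrankP s g (rank s g i); rewrite mem_iota in hi.
  by apply: rank_ltn; lia.
Qed.

Lemma rank_trunc s h i : 1 <= h i -> rank s (trunc \o h) i = rank s h i.
Proof. by move=> hi; apply: eq_count => x; rewrite /before /trunc /=; lia. Qed.

Lemma eq_in_rank s g g' i : (1 <= i <= s)%N ->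
  {in iota 1 s, g =1 g'} -> rank s g i = rank s g' i.
Proof.
move=> hi e; apply: eq_in_count => x hx; rewrite /before !e //.
rewrite mem_iota; lia.
Qed.

(** Two states with the same truncation still have the same truncation after a
    letter of rank [w] is read, where the ranks are those of [h] and those of
    the truncation of [h']: if either letter fills a cell in a positive row,
    then both letters agree; otherwise no positive row is touched. *)
Lemma unrank_trunc s h h' w : (w < s)%N ->
    {in iota 1 s, trunc \o h =1 trunc \o h'} ->
  let i := unrank s h w in let i' := unrank s (trunc \o h') w in
  {in iota 1 s, trunc \o decr h i =1 trunc \o decr h' i'}.
Proof.
move=> lt_ws e i i'.
have [hi ri] := unrankP h lt_ws; have [hi' ri'] := unrankP (trunc \o h') lt_ws.
rewrite -/i -/i' in hi ri hi' ri'.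
have Hi : i \in iota 1 s by rewrite mem_iota; lia.
have Hi' : i' \in iota 1 s by rewrite mem_iota; lia.
have ei := e _ Hi; have ei' := e _ Hi'; rewrite /trunc /= in ei ei'.
have re x : (1 <= x <= s)%N -> 1 <= h x -> rank s (trunc \o h') x = rank s h x.
  by move=> hx gx; rewrite -[RHS]rank_trunc //; apply: eq_in_rank => // y /e ->.
have [le0|gt0] := boolP ((h i <= 0) && (h' i' <= 0)).
  move=> x hx; move: (e _ hx); rewrite /trunc /decr /=.
  case: (x =P i) => [->|_]; first by case: (i =P i') => _; lia.
  by case: (x =P i') => [->|_]; lia.
have e_ii' : i = i'.
  apply: (@rank_inj s (trunc \o h')) => //.
  have [gi|ngi] := boolP (1 <= h i); first by rewrite re // ri ri'.
  have gi' : 1 <= h i' by lia.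
  have e' : rank s h i = rank s h i' by rewrite -(re i') // ri ri'.
  by rewrite (rank_inj Hi Hi' e').
move=> x hx; move: (e _ hx); rewrite /trunc /decr /= -e_ii'.
by case: (x =P i) => [->|_]; lia.
Qed.

(** The generating functions of the two kinds of weights agree, for any sequence
    [a] of labels: summing over the rank of the first letter, rather than over
    the letter, makes the two recursions identical. The pair [p] stands for the
    label and the weight of the preceding letter. *)
Lemma sum_words_trunc s a p h h' :
    {in iota 1 s, trunc \o h =1 trunc \o h'} ->
  \sum_(u <- words s (size a) |
       path tie p (zip a (weights id s h u)) && covers s h u)
      'X^(sumn (weights id s h u)) =
  \sum_(u <- words s (size a) |
       path tie p (zip a (weights trunc s h' u)) && covers s h' u)
      'X^(sumn (weights trunc s h' u)) :> {poly int}.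
Proof.
elim: a p h h' => [|x a IH] p h h' e.
  rewrite /= !big_cons !big_nil; congr (if _ then _ else _).
  by apply: eq_in_all => i /e; rewrite /trunc /free_row /=; lia.
rewrite [size _]/= !sum_wordsS (sum_rank s h) [RHS](sum_rank s (trunc \o h')).
apply: eq_big_seq => w; rewrite mem_iota => /andP[_ lt_w] /=.
have [_ r1] := unrankP h lt_w; have [_ r2] := unrankP (trunc \o h') lt_w.
have -> : rank s (id \o h) (unrank s h w) = w by exact: r1.
rewrite r2.
have E g i u : covers s g (i :: u) = covers s (decr g i) u.
  by apply: eq_in_all => y _; rewrite free_row_cons.
under eq_bigl do rewrite E -andbA.
under [RHS]eq_bigl do rewrite E -andbA.
under eq_bigr do rewrite exprD.
under [RHS]eq_bigr do rewrite exprD.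
case: (tie p (x, w)); last by rewrite !big_pred0.
by rewrite -!big_distrr /= (IH _ _ _ (unrank_trunc lt_w e)).
Qed.

(** * Fillings and words *)

(** The filling whose diagram is [cs] and which labels the [t]-th cell of [cs]
    with the [t]-th entry of [a]; it is used with [cs] and [a] of the same
    size. *)
Definition fill (cs : seq cell) (a : seq nat) : filling :=
  [fmap c : [fset x in cs]%fset => nth 0%N a (index (val c) cs)]%fmap.

Lemma mem_fill cs a c : (c \in domf (fill cs a)) = (c \in cs).
Proof. by rewrite in_fset. Qed.

Lemma label_fill cs a c :
  c \in cs -> label (fill cs a) c = nth 0%N a (index c cs).
Proof.
move=> hc; have hd : c \in domf (fill cs a) by rewrite mem_fill.
by rewrite /label (in_fnd hd) /= ffunE.
Qed.

Lemma eq_fill (phi : filling) cs a :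
    domf phi =i cs ->
    {in cs, forall c, label phi c = nth 0%N a (index c cs)} ->
  phi = fill cs a.
Proof.
move=> ed el; apply/fmapP=> c; have [hc|nc] := boolP (c \in cs).
  have hd : c \in domf phi by rewrite ed.
  have hd' : c \in domf (fill cs a) by rewrite mem_fill.
  have := el _ hc; rewrite -(label_fill a hc) /label.
  by rewrite (in_fnd hd) (in_fnd hd') /= => ->.
by rewrite !not_fnd // ?mem_fill // ed.
Qed.

Lemma map_label_fill cs a : uniq cs -> size a = size cs ->
  map (label (fill cs a)) cs = a.
Proof.
move=> ucs ea; apply: (@eq_from_nth _ 0%N); rewrite size_map // => i hi.
rewrite (nth_map (0%N, 0)) // label_fill ?mem_nth //.
by rewrite index_uniq.
Qed.

Lemma perm_enum_domf (phi : filling) cs : uniq cs -> domf phi =i cs ->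
  perm_eq (enum_fset (domf phi)) cs.
Proof. by move=> ucs e; apply: uniq_perm => //; apply: fset_uniq. Qed.

(** The order in which the cells of a filling with labels [l] are listed: by
    label, then by the reading order of their images under [rho], then from top
    to bottom (needed when [rho] merges several rows). *)
Definition forder (rho : int -> int) (l : cell -> nat) (c c' : cell) : bool :=
  (l c < l c')%N || (l c == l c') &&
  ((rho c'.2 < rho c.2) || (rho c.2 == rho c'.2) &&
   ((c.1 < c'.1)%N || (c.1 == c'.1) && (c'.2 <= c.2))).

Lemma forder_trans rho l : transitive (forder rho l).
Proof.
move=> y x z; rewrite /forder; move: (l x) (l y) (l z) => a b c.
move: (rho x.2) (rho y.2) (rho z.2) => a' b' c'; lia.
Qed.

Lemma forder_total rho l : total (forder rho l).
Proof.
move=> x y; rewrite /forder; move: (l x) (l y) => a b.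
by move: (rho x.2) (rho y.2) => a' b'; lia.
Qed.

Lemma forder_anti rho l : antisymmetric (forder rho l).
Proof.
move=> [x1 x2] [y1 y2]; rewrite /forder; move: (l _) (l _) => a b /=.
move: (rho x2) (rho y2) => a' b' H.
by have [-> ->] : x1 = y1 /\ x2 = y2 by lia.
Qed.

(** For pairs (label, cell): the cells of equal labels are in reading order, up
    to [rho]. *)
Definition cell_tie (rho : int -> int) (p p' : nat * cell) : bool :=
  (p.1 == p'.1) ==>
  reading (p.2.1, rho p.2.2) (p'.2.1, rho p'.2.2).

(** The initial state: the top row of each column. *)
Definition top_row (la : seq nat) (i : nat) : int := (part la i)%:Z.

(** The words that represent the fillings of content [a]: among the words that
    produce the same filling, the one that lists cells of equal labels in
    reading order, up to [rho], is selected. *)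
Definition canonical (rho : int -> int) (la : seq nat) (s : nat) (a u : seq nat) :=
  covers s (top_row la) u && sorted (cell_tie rho) (zip a (cells (top_row la) u)).

Lemma mem_dg la s c :
  (c \in dg la s) = (1 <= c.1 <= s)%N && (1 <= c.2 <= top_row la c.1).
Proof.
rewrite /dg /top_row; apply/idP/idP.
  case/imfset2P=> i; rewrite ?inE mem_iota => hi [j].
  rewrite ?inE mem_iota => hj -> /=; lia.
case: c => i j /= h; apply/imfset2P; exists i; first by rewrite ?inE mem_iota; lia.
exists `|j|%N; first by rewrite ?inE mem_iota; lia.
congr pair; lia.
Qed.

Lemma mem_basement b s c :
  (c \in basement b s) = (1 <= c.1 <= s)%N && (- (b c.1)%:Z < c.2 <= 0).
Proof.
rewrite /basement; apply/idP/idP.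
  case/imfset2P=> i; rewrite ?inE mem_iota => hi [j].
  rewrite ?inE mem_iota => hj -> /=; lia.
case: c => i j /= h; apply/imfset2P; exists i; first by rewrite ?inE mem_iota; lia.
exists `|j|%N; first by rewrite ?inE mem_iota; lia.
congr pair; lia.
Qed.

Section Bijection.

Variables (rho : int -> int) (la : seq nat) (s : nat) (a : seq nat).
Hypothesis rho_mono : forall j j' : int, j <= j' -> rho j <= rho j'.
Hypothesis a_sorted : sorted leq a.

Let cs u := cells (top_row la) u.
Let n := size a.

Lemma canonical_sorted u : size u = n -> canonical rho la s a u ->
  sorted (forder rho (label (fill (cs u) a))) (cs u).
Proof.
move=> su /andP[_ /(sortedP (0%N, (0%N, 0))) H].
have sc : size (cs u) = n by rewrite size_cells.
apply/(sortedP (0%N, 0)) => i hi; have hi' : (i < size (cs u))%N by exact: ltnW.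
rewrite /forder !label_fill ?mem_nth // !index_uniq ?cells_uniq //.
have /(sortedP 0%N)/(_ i) := a_sorted; rewrite -/n -sc => /(_ hi).
have := H i; rewrite size_zip -/n size_cells su minnn -su -(size_cells (top_row la)).
move=> /(_ hi); rewrite /cell_tie !nth_zip ?size_cells ?su //=.
have /(pairwiseP (0%N, 0))/(_ i i.+1 hi' hi (leqnn _)) :=
  cells_pairwise (top_row la) u.
rewrite -/(cs u); move: (nth 0%N a i) (nth 0%N a i.+1) => x y.
move: (nth _ (cs u) i) (nth _ (cs u) i.+1) => [x1 x2] [y1 y2] /=.
rewrite /reading /=; move: (rho x2) (rho y2) => x3 y3; lia.
Qed.

Lemma fill_inj u u' :
    size u = n -> size u' = n -> canonical rho la s a u -> canonical rho la s a u' ->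
  fill (cs u) a = fill (cs u') a -> u = u'.
Proof.
move=> su su' gu gu' e; rewrite -(map_fst_cells (top_row la) u).
rewrite -(map_fst_cells (top_row la) u'); congr map.
apply: (sorted_eq (@forder_trans rho (label (fill (cs u) a))) (@forder_anti _ _)).
- exact: canonical_sorted.
- by rewrite e; apply: canonical_sorted.
apply: uniq_perm; rewrite ?cells_uniq // => c.
by have := mem_fill (cs u) a c; rewrite e mem_fill.
Qed.

Lemma fill_ECI u :
    all (leq 1) a -> u \in words s n -> canonical rho la s a u ->
  ECI n la s (fill (cs u) a) /\ xmon (fill (cs u) a) = seq_mset a.
Proof.
rewrite mem_words => a_gt0 /andP[/eqP su /allP us] gu.
have sc : size a = size (cs u) by rewrite size_cells su.
have domE := mem_fill (cs u) a.
have pe := perm_enum_domf (cells_uniq _ _) domE.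
split; last first.
  apply/eq_seq_msetP; rewrite -[X in perm_eq _ X](map_label_fill _ sc) ?cells_uniq //.
  exact: perm_map.
split.
- exists (fun i => (count_mem i u - part la i)%N).
  apply/fsetP=> -[i j]; rewrite domE in_fsetU mem_dg mem_basement mem_cells /=.
  rewrite /free_row /top_row; have [hi|ni] := boolP (i \in iota 1 s).
    case/andP: gu => /allP/(_ _ hi); rewrite /free_row /top_row /=.
    by rewrite mem_iota in hi; lia.
  have -> : count_mem i u = 0%N by apply/count_memPn; apply: contra ni => /us.
  by rewrite mem_iota in ni; lia.
- by rewrite (perm_size pe) size_cells.
- move=> c; rewrite domE => hc; rewrite label_fill //.
  by apply: (allP a_gt0); apply: mem_nth; rewrite sc index_mem.
- move=> c c'; rewrite !domE => hc hc' e1 lt2; rewrite !label_fill //.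
  have lt : (index c (cs u) <= index c' (cs u))%N.
    rewrite leqNgt; apply/negP=> lt.
    have /(pairwiseP (0%N, 0)) := cells_pairwise (top_row la) u.
    move=> /(_ _ _ _ _ lt); rewrite !nth_index // => H.
    have := H _ _; rewrite !inE !index_mem e1 eqxx /= => /(_ hc' hc).
    by move=> /(lt_trans lt2); rewrite ltxx.
  by apply: (sorted_leq_nth leq_trans leqnn 0%N a_sorted) => //; rewrite inE sc index_mem.
Qed.

(** Every filling of content [a] comes from a canonical word: list its cells in
    the order [forder] and keep their columns. *)
Lemma ECI_fill (phi : filling) :
    ECI n la s phi -> xmon phi = seq_mset a ->
  exists u, [/\ u \in words s n, canonical rho la s a u & phi = fill (cs u) a].
Proof.
case=> -[b domE] card_n pos col xm.
set l := sort (forder rho (label phi)) (enum_fset (domf phi)).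
have l_sorted : sorted (forder rho (label phi)) l.
  by apply: sort_sorted; apply: forder_total.
have l_perm : perm_eq l (enum_fset (domf phi)) by rewrite /l perm_sort.
have l_uniq : uniq l by rewrite (perm_uniq l_perm) fset_uniq.
have meml c : (c \in l) = (c \in domf phi) by rewrite (perm_mem l_perm).
have size_l : size l = n by rewrite (perm_size l_perm).
(* The number of cells in column [i] of the diagram. *)
pose M i := if i \in iota 1 s then (part la i + b i)%N else 0%N.
have colE i : [seq c <- l | c.1 == i] =
    [seq (i, top_row la i - j%:Z) | j <- iota 0 (M i)].
  pose below (c c' : cell) := c'.2 < c.2.
  have below_irr : irreflexive below by move=> c; apply: ltxx.
  have below_tr : transitive below by move=> x y z h1 h2; apply: lt_trans h2 h1.
  apply: (irr_sorted_eq below_tr below_irr).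
  - (* The listing goes down each column: labels weakly increase that way, and
       so does the order by which [forder] breaks ties, since [rho] is
       monotone. *)
    apply/(sortedP (0%N, 0)) => t ht; set f := filter _ l in ht *.
    have fu : uniq f by rewrite filter_uniq.
    have /(sortedP (0%N, 0))/(_ t ht) : sorted (forder rho (label phi)) f.
      by apply: sorted_filter l_sorted; apply: forder_trans.
    have := mem_nth (0%N, 0) ht; have := mem_nth (0%N, 0) (ltnW ht).
    have : nth (0%N, 0) f t != nth (0%N, 0) f t.+1.
      by rewrite nth_uniq // ?(ltnW ht) // neq_ltn leqnn.
    move: (nth _ f t) (nth _ f t.+1) => c d ne.
    rewrite !mem_filter !meml => /andP[/eqP ci hc] /andP[/eqP di hd].
    rewrite /forder /below; apply: contraLR; rewrite -leNgt => le_cd.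
    have lt_cd : c.2 < d.2.
      rewrite lt_neqAle le_cd andbT; apply: contra ne => /eqP e2.
      by rewrite [c]surjective_pairing [d]surjective_pairing ci di e2.
    have := col d c hd hc; rewrite ci di => /(_ erefl lt_cd) le_l.
    have := rho_mono le_cd.
    move: (rho c.2) (rho d.2) (label phi c) (label phi d) le_l lt_cd.
    by move=> x y z w; lia.
  - rewrite sorted_map; apply: sub_sorted (iota_ltn_sorted 0 (M i)) => x y.
    by rewrite /below /=; lia.
  case=> x y; rewrite mem_filter meml domE in_fsetU mem_dg mem_basement /=.
  apply/idP/mapP => [/andP[/eqP ->] h|[j]].
    exists `|top_row la i - y|%N; last by rewrite /top_row in h *; congr pair; lia.
    by rewrite mem_iota /M mem_iota; rewrite /top_row in h *; case: ifP; lia.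
  rewrite mem_iota /M mem_iota => hj [-> ->]; rewrite eqxx /top_row.
  by move: hj; case: ifP; lia.
have cntE i : count_mem i (map fst l) = M i.
  by have := congr1 size (colE i); rewrite size_filter size_map size_iota count_map.
have cE : cs (map fst l) = l.
  by apply: cells_of_columns => i; rewrite cntE.
have aE : map (label phi) l = a.
  apply: (sorted_eq leq_trans anti_leq) => //.
    rewrite sorted_map; apply: sub_sorted l_sorted => c c'.
    by rewrite /forder /=; lia.
  apply: perm_trans (perm_map _ l_perm) _; exact/eq_seq_msetP.
have phiE : phi = fill (cs (map fst l)) a.
  rewrite cE; apply: eq_fill => [c|c hc]; first by rewrite meml.
  by rewrite -aE (nth_map (0%N, 0)) ?index_mem // nth_index.
exists (map fst l); split => //.
  rewrite mem_words size_map size_l eqxx /=; apply/allP=> _ /mapP[c hc ->].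
  by move: hc; rewrite meml domE in_fsetU mem_dg mem_basement /= mem_iota; lia.
apply/andP; split.
  by apply/allP=> i hi; rewrite /free_row cntE /M hi /top_row; lia.
apply/(sortedP (0%N, (0%N, 0))) => i; rewrite -/(cs _) cE size_zip -/n size_l minnn.
move=> hi; rewrite !nth_zip //= /cell_tie /=.
have /(sortedP (0%N, 0))/(_ i) := l_sorted; rewrite size_l => /(_ hi).
rewrite -aE !(nth_map (0%N, 0)) ?size_l //; last exact: ltnW.
by rewrite /forder /reading /=; lia.
Qed.

End Bijection.

(** * The statistics are sums of weights *)

(** Counts, cell by cell, a set parametrized injectively by a column [i] and a
    cell [c]. Sets of pairs of a cell [c] and a cell attacking [c] are of this
    form, because a column contains at most one cell attacking [c]. *)
Lemma card_by_columns (T : choiceType) (A : set T) (e : nat -> cell -> T)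
    (P : nat -> cell -> bool) (s : nat) (cs : seq cell) :
    uniq cs ->
    (forall i c i' c', e i c = e i' c' -> i = i' /\ c = c') ->
    (forall x, A x <-> exists i c, [/\ i \in iota 1 s, c \in cs, P i c & x = e i c]) ->
  #|` fset_set A| = sumn [seq count (P ^~ c) (iota 1 s) | c <- cs].
Proof.
move=> ucs e_inj AE.
set L := [seq e i c | c <- cs, i <- [seq i <- iota 1 s | P i c]].
have uL : uniq L.
  apply: allpairs_uniq_dep => // [c _|]; first by rewrite filter_uniq ?iota_uniq.
  by move=> [c i] [c' i'] _ _ /= /e_inj[-> ->].
have -> : A = [set` [fset x in L]%fset]%classic.
  apply/seteqP; split=> x /=; rewrite in_fset /=.
    move=> /AE[i [c [hi hc hP ->]]]; apply/allpairsPdep; exists c, i.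
    by rewrite mem_filter hP.
  move=> /allpairsPdep[c [i [hc]]]; rewrite mem_filter => /andP[hP hi] ->.
  by apply/AE; exists i, c.
rewrite set_fsetK.
have /perm_size -> : perm_eq (enum_fset [fset x in L]%fset) L.
  by apply: uniq_perm; rewrite ?fset_uniq // => x; rewrite in_fset.
rewrite size_allpairs_dep; congr sumn; apply: eq_map => c.
by rewrite size_filter.
Qed.

Lemma free_row_take h u t i : free_row h (take t u) i <= h i.
Proof. by rewrite /free_row; lia. Qed.

Lemma notin_take_cells h u t c : c.2 <= h c.1 ->
  (c \notin take t (cells h u)) = (c.2 <= free_row h (take t u) c.1).
Proof. by move=> hc; rewrite take_cells mem_cells hc andbT -leNgt. Qed.

Lemma free_row_cells h u (c : cell) : c \in cells h u ->
  free_row h (take (index c (cells h u)) u) c.1 = c.2.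
Proof.
move=> hc; have lt : (index c (cells h u) < size u)%N.
  by rewrite -(size_cells h) index_mem.
have := nth_cells h lt; rewrite nth_index // => e.
by rewrite {2 3}e.
Qed.

Lemma weights_cells rho s h u :
  weights rho s h u =
  [seq rank s (rho \o free_row h (take (index c (cells h u)) u)) c.1 |
     c <- cells h u].
Proof.
apply: (@eq_from_nth _ 0%N); rewrite ?size_map size_weights ?size_cells // => t ht.
rewrite (nth_map (0%N, 0)) ?size_cells // index_uniq ?cells_uniq ?size_cells //.
by rewrite nth_cells // nth_weights.
Qed.

Section Statistics.

Variables (la : seq nat) (s : nat) (a u : seq nat).
Hypothesis a_sorted : sorted leq a.
Hypothesis u_word : u \in words s (size a).

Let cs := cells (top_row la) u.
Let phi := fill cs a.
(* The state just before the cell [c] is filled. *)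
Let g (c : cell) := free_row (top_row la) (take (index c cs) u).

Let size_u : size u = size a.
Proof. by move: u_word; rewrite mem_words => /andP[/eqP]. Qed.

Lemma cells_col (c : cell) : c \in cs -> (1 <= c.1 <= s)%N.
Proof.
move=> hc; have : c.1 \in u.
  by rewrite -(map_fst_cells (top_row la) u); apply: map_f.
move: u_word; rewrite mem_words => /andP[_ /allP us] /us /=.
by rewrite mem_iota.
Qed.

(** The label of [c] exceeds that of [c'] exactly when [c] is still empty at the
    time when [c'] is filled. This can fail for equal labels, which are excluded
    by requiring that [c] strictly precede [c'] in reading order, up to [rho]:
    then [c'] is not filled before a cell [c] of the same label. *)
Lemma label_lt rho (c c' : cell) : canonical rho la s a u -> c \in cs -> c' \in cs ->
    ~~ reading (c'.1, rho c'.2) (c.1, rho c.2) ->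
  (label phi c' < label phi c)%N = (c.2 <= g c' c.1).
Proof.
move=> gu hc hc' nr; have so := canonical_sorted a_sorted size_u gu.
have hc2 : c.2 <= top_row la c.1 by move: hc; rewrite mem_cells => /andP[].
rewrite -(notin_take_cells _ _ hc2) in_take // -leqNgt -/cs.
have [le|lt] := leqP (index c' cs) (index c cs).
  have lt : (index c' cs < index c cs)%N.
    rewrite ltn_neqAle le andbT; apply: contra nr => /eqP e.
    have -> : c' = c by rewrite -[c'](nth_index c hc') e nth_index.
    by rewrite /reading /=; lia.
  have := sorted_ltn_index (@forder_trans _ _) so _ _ hc' hc lt.
  move: nr; rewrite /reading /forder -/phi; move: (label phi c') (label phi c).
  case: c {hc hc2 le lt} => x y; case: c' {hc'} => x' y' /=.
  by move: (rho y) (rho y') => z z'; lia.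
have := sorted_ltn_index (@forder_trans _ _) so _ _ hc hc' lt.
rewrite /forder -/phi; move: (label phi c') (label phi c) => x y.
by case: ltngtP.
Qed.

Lemma dg_cells rho (c : cell) : canonical rho la s a u -> c \in dg la s -> c \in cs.
Proof.
case/andP=> /allP fin _; rewrite mem_dg mem_cells => /andP[hc1 hc2].
case: c hc1 hc2 => x y /= hx hy.
have := fin x; rewrite mem_iota => H.
have : free_row (top_row la) u x <= 0 by apply: H; lia.
by move: hy; move: (free_row _ _ _) (top_row _ _) => l t; lia.
Qed.

Lemma unfilled_row_le0 rho (c : cell) : canonical rho la s a u -> (1 <= c.1 <= s)%N ->
  c.2 <= top_row la c.1 -> c \notin cs -> c.2 <= 0.
Proof.
case/andP=> /allP fin _ hc1 hc2; rewrite mem_cells hc2 andbT -leNgt => hc3.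
have := fin c.1; rewrite mem_iota => H.
have : free_row (top_row la) u c.1 <= 0 by apply: H; lia.
exact: le_trans.
Qed.

(** Both kinds of pairs counted by dinv are the pairs [(c, c')] such that [c]
    attacks [c'] and is empty when [c'] is filled: (D1) if [c] is filled later,
    (D2) if it is never filled. *)
Lemma dinv_fill : canonical id la s a u ->
  dinv la s phi = sumn (weights id s (top_row la) u).
Proof.
move=> gu; rewrite weights_cells /dinv.
apply: (card_by_columns (e := fun i c' => ((i, c'.2 + (c'.1 < i)%N%:Z), c'))
  (P := fun i c' => before (g c') i c'.1)); first exact: cells_uniq.
  by move=> i c i' c' [-> _ ->].
(* [c.2 + (c.1 < i)] is the row in which column [i] attacks [c]. *)
have attE i (c : cell) : c \in cs ->
    before (g c) i c.1 = (i != c.1) && (c.2 + (c.1 < i)%N%:Z <= g c i).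
  by move=> hc; rewrite /before [g c c.1]free_row_cells //; case: c {hc} => x y /=; lia.
move=> [[x y] c']; rewrite /attacking_pair /coordinate /attacks; split.
  case: c' => x' y' /= [/and3P[/andP[hx hy] /andP[hx' hy'] att] H].
  have hc' : (x', y') \in cs by case: H => [[_ + _]|[_ _ _]]; rewrite ?in_fset.
  have ne : x != x' by lia.
  have ey : y = y' + (x' < x)%N by lia.
  exists x, (x', y'); rewrite attE //= ne -ey mem_iota; split=> //=.
  case: H => [[]|[_ _]]; rewrite ?in_fset => hc.
    by move=> _; rewrite (@label_lt id) // /reading /=; lia.
  move=> _; rewrite -[X in is_true X](@notin_take_cells _ u _ (x, y)) //.
  by apply: contra hc; apply: mem_take.
case=> i [d [hi hd]]; rewrite attE // => /andP[ne le] [-> -> ->] {x y c'}.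
have hi2 := le_trans le (free_row_take _ _ _ _).
have hd1 := cells_col hd; have : d.2 <= top_row la d.1.
  by move: hd; rewrite mem_cells => /andP[].
case: d hd le ne hd1 hi2 => x y hd /= le ne hx hi2 hy; rewrite mem_iota in hi.
split; first by rewrite hi2 hy; lia.
rewrite ?in_fset; have [hc|nc] := boolP ((i, y + (x < i)%N) \in cs).
  by left; split => //; rewrite (@label_lt id) // /reading /=; lia.
right; have := unfilled_row_le0 gu _ _ nc; rewrite /= => /(_ _ hi2) c0.
have {}c0 : y + (x < i)%N <= 0 by apply: c0; lia.
by split=> //; lia.
Qed.

(** In a positive row (I1) counts as dinv does. For a cell in a basement, (I2)
    counts the columns further right with an empty cell in row 1, and (I3) all
    the columns further left; this is the rank once all basement rows are
    identified with row 0. Basement cells are never compared with each other, so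
    [rho] need only separate the rows from 0 upwards. *)
Lemma inv_fill (rho : int -> int) : (forall j j' : int, j <= j' -> rho j <= rho j') ->
    (forall j : int, 0 <= j -> rho j < rho (j + 1)) -> canonical rho la s a u ->
  inv la s phi = sumn (weights trunc s (top_row la) u).
Proof.
move=> rho_mono rho_lt gu; rewrite weights_cells /inv.
pose P1 i (c : cell) := (1 <= c.2) && before (g c) i c.1.
pose P2 i (c : cell) := [&& c.2 <= 0, (c.1 < i)%N & 1 <= g c i].
pose P3 i (c : cell) := (c.2 <= 0) && (i < c.1)%N.
have domE c : (c \in domf phi) = (c \in cs) by apply: mem_fill.
have inv1E : inv1 la s phi = sumn [seq count (P1 ^~ c) (iota 1 s) | c <- cs].
  rewrite /inv1 -[X in #|` X|]set_fsetK.
  apply: (card_by_columns (e := fun i c' => ((i, c'.2 + (c'.1 < i)%N%:Z), c'))).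
  - exact: cells_uniq.
  - by move=> i c i' c' [-> _ ->].
  move=> [c c']; rewrite /= !inE /=; split.
    case/andP=> /andP[hc hc'] /andP[att lt].
    have Hc := dg_cells gu hc; have Hc' := dg_cells gu hc'.
    have gc' := free_row_cells Hc'; rewrite -/cs -/(g c') in gc'.
    exists c.1, c'; move: lt; rewrite (@label_lt rho) //; last first.
      move: hc hc' att; rewrite !mem_dg /attacks /reading {Hc Hc' gc'}.
      case: c c' => x y [x' y'] /= hx hx' att.
      have [e|e] : y = y' \/ y = y' + 1 by lia.
        by move: att; rewrite e; lia.
      have := rho_lt y'; rewrite -e => H; have : rho y' < rho y by apply: H; lia.
      by move: (rho y) (rho y') => ? ?; lia.
    move=> le; move: hc hc' att le gc'; rewrite !mem_dg /attacks /P1 /before mem_iota.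
    case: c c' Hc Hc' => x y [x' y'] /= Hc Hc' hx hx' att le gc'; rewrite gc'.
    by split=> //; [lia | lia | congr pair; congr pair; lia].
  case=> i [d [hi hd hP]] [-> ->] {c c'}.
  have gd := free_row_cells hd; rewrite -/cs -/(g d) in gd.
  have hd1 := cells_col hd; rewrite mem_iota in hi.
  move: hP; rewrite /P1 /before gd => /andP[hd2 hb].
  have hg : g d i <= top_row la i by apply: free_row_take.
  have hd3 : d.2 <= top_row la d.1 by move: hd; rewrite mem_cells => /andP[].
  set c := (i, d.2 + (d.1 < i)%N).
  have hcd : c \in dg la s.
    rewrite mem_dg /c /=; move: (hd2) (hb) hg; move: (g d i).
    by case: (d) => x y G /= *; lia.
  have -> : d \in dg la s by rewrite mem_dg hd1 hd2.
  rewrite hcd (@label_lt rho) //.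
  - rewrite /c /attacks /=; move: hb hd2; move: (g d i).
    by case: (d) => x y G /= *; lia.
  - exact: dg_cells gu hcd.
  rewrite /c /reading /=; have := rho_lt d.2; move: hd2 hb; move: (g d i).
  case: (d) => x y G /= hd2 hb H.
  have {}H : rho y < rho (y + 1) by apply: H; lia.
  case: (ltnP x i) => hxi; move: H; rewrite ?addr0; move: (rho _) (rho _) => *.
    by lia.
  by lia.
have inv2E : inv2 la s phi = sumn [seq count (P2 ^~ c) (iota 1 s) | c <- cs].
  rewrite /inv2 -[X in #|` X|]set_fsetK.
  apply: (card_by_columns (e := fun i c' => ((i, 1), c'))).
  - exact: cells_uniq.
  - by move=> i c i' c' [-> ->].
  have nr i (c : cell) : c.2 <= 0 -> ~~ reading (c.1, rho c.2) (i, rho 1).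
    have := rho_lt 0 (lexx _); rewrite add0r /reading /= => h1 h2.
    have := rho_mono _ _ h2; move: h1; move: (rho 0) (rho 1) (rho c.2) => *; lia.
  move=> [c c']; rewrite /= !inE /=; split.
    case/andP=> /andP[hc hc'] /and3P[c1 lt lt'].
    case/andP: hc' => hc' c'0.
    exists c.1, c'; have Hc := dg_cells gu hc; move: lt'.
    rewrite (@label_lt rho) //; last by rewrite (eqP c1) nr.
    rewrite (eqP c1) /P2 c'0 lt => ->; split=> //.
      by move: hc; rewrite mem_dg mem_iota => /andP[].
    by rewrite -(eqP c1) -surjective_pairing.
  case=> i [d [hi hd /and3P[hd0 lt hg]]] [-> ->] {c c'}.
  have hcd : (i, 1) \in dg la s.
    rewrite mem_dg /= (le_trans hg (free_row_take _ _ _ _)).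
    by move: hi; rewrite mem_iota => hi; rewrite andbT; lia.
  rewrite hcd hd hd0 lt (@label_lt rho) //=.
    exact: dg_cells gu hcd.
  exact: nr.
have inv3E : inv3 s phi = sumn [seq count (P3 ^~ c) (iota 1 s) | c <- cs].
  rewrite /inv3 -[X in #|` X|]set_fsetK.
  apply: (card_by_columns (e := fun i c' => (i, c'))).
  - exact: cells_uniq.
  - by move=> i c i' c' [-> ->].
  move=> [i c]; rewrite /= !inE /P3; split.
    by case/andP=> /andP[hi /andP[hc c0]] lt; exists i, c; rewrite c0.
  by case=> j [d [hi hd /andP[h0 lt]]] [-> ->]; rewrite hi hd h0.
rewrite inv1E inv2E inv3E !sumnE !big_map -!big_split /=.
apply: eq_big_seq => -[x y] hc; rewrite /rank.
have := free_row_cells hc; rewrite -/cs -/(g _) /= => gc.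
have [y1|y1] := boolP (1 <= y).
  rewrite (@eq_count _ (P2 ^~ _) pred0); last by move=> i; rewrite /P2 /=; lia.
  rewrite (@eq_count _ (P3 ^~ _) pred0); last by move=> i; rewrite /P3 /=; lia.
  rewrite count_pred0 !addn0; apply: eq_count => i.
  by rewrite /P1 y1 /before /trunc /= gc; move: (g _ i) => *; lia.
rewrite (@eq_count _ (P1 ^~ _) pred0); last by move=> i; rewrite /P1 /=; lia.
rewrite count_pred0 add0n -count_predUI.
rewrite (@eq_count _ (predI _ _) pred0); last first.
  by move=> i /=; rewrite /P2 /P3 /=; lia.
rewrite count_pred0 addn0; apply: eq_count => i /=.
by rewrite /P2 /P3 /before /trunc /= gc; move: (g _ i) => *; lia.
Qed.

End Statistics.

(** * Sums over fillings as sums over words *)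

Lemma path_tie_weights rho s (h : nat -> int) a x i u :
    (forall j j' : int, j <= j' -> rho j <= rho j') ->
    (1 <= i <= s)%N -> all (mem (iota 1 s)) u ->
  path tie (x, rank s (rho \o h) i) (zip a (weights rho s (decr h i) u)) =
  path (cell_tie rho) (x, (i, h i)) (zip a (cells (decr h i) u)).
Proof.
move=> rho_mono; elim: u h a x i => [|i' u IH] h [|y a] x i //= hi /andP[hi' hu].
rewrite mem_iota in hi'; rewrite IH //; congr (_ && _).
rewrite /tie /cell_tie /=; congr (_ ==> _); apply: leq_rank_step => //.
- by move=> z nz; rewrite /decr /= (negbTE nz) subr0.
- by apply: rho_mono; rewrite /decr; lia.
Qed.

Lemma canonical_weights rho la s a u :
    (forall j j' : int, j <= j' -> rho j <= rho j') -> u \in words s (size a) ->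
  canonical rho la s a u =
  sorted tie (zip a (weights rho s (top_row la) u)) && covers s (top_row la) u.
Proof.
move=> rho_mono; rewrite mem_words => /andP[_ hu].
rewrite /canonical andbC; congr (_ && _).
case: a u hu => [|y a] [|i u] //= /andP[hi hu].
by rewrite path_tie_weights //; move: hi; rewrite mem_iota; lia.
Qed.

(** Canonical words are in bijection with the fillings of content [a]. *)
Lemma sum_fillings_words (R : nmodType) rho la s a (A : set filling) (F : filling -> R) :
    (forall j j' : int, j <= j' -> rho j <= rho j') ->
    sorted leq a -> all (leq 1) a ->
    (forall phi, A phi <-> ECI (size a) la s phi /\ xmon phi = seq_mset a) ->
  \sum_(phi \in A) F phi =
  \sum_(u <- words s (size a) | canonical rho la s a u) F (fill (cells (top_row la) u) a).
Proof.
move=> rho_mono a_sorted a_gt0 AE.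
set L := [seq fill (cells (top_row la) u) a |
  u <- words s (size a) & canonical rho la s a u].
have uL : uniq L.
  rewrite map_inj_in_uniq ?filter_uniq ?words_uniq // => u u'.
  rewrite !mem_filter !mem_words.
  move=> /andP[gu /andP[/eqP su _]] /andP[gu' /andP[/eqP su' _]].
  exact: fill_inj gu gu'.
have -> : A = [set` L]%classic.
  apply/seteqP; split=> phi /=.
    move=> /AE[hE hx]; have [u [hu gu ->]] := ECI_fill rho_mono a_sorted hE hx.
    by apply: map_f; rewrite mem_filter gu.
  move=> /mapP[u]; rewrite mem_filter => /andP[gu hu] ->; apply/AE.
  exact: fill_ECI hu gu.
by rewrite -fsbig_seq // big_map big_filter.
Qed.

Lemma ECI_labels n la s phi : ECI n la s phi ->
  size (labels phi) = n /\ all (leq 1) (labels phi).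
Proof.
case=> _ hn hp _; rewrite size_map; split=> //.
by apply/allP=> _ /mapP[c hc ->]; apply: hp.
Qed.

(** * Fundamental quasisymmetric functions and standardization *)

(** All coefficients of a fundamental quasisymmetric function are 0 or 1, since
    a monomial is the content of a single weakly increasing sequence. *)
Lemma gessel_F_eval n (D : {fset nat}) (a : seq nat) :
    size a = n -> sorted leq a -> all (leq 1) a ->
  gessel_F n D (seq_mset a) =
  if `[< {in D, forall i, (nth 0%N a i.-1 < nth 0%N a i)%N} >] then 1 else 0.
Proof.
move=> sa a_sorted a_gt0; rewrite /gessel_F /formal_sum.
have uniq_a (t : n.-tuple nat) : sorted leq t -> seq_mset t = seq_mset a ->
    val t = a.
  move=> st /eq_seq_msetP pt; exact: (sorted_eq leq_trans anti_leq).
case: asboolP => [ok|nok]; last first.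
  by apply: fsbig1 => t [[_ st ok] /(uniq_a _ st) e]; case: nok; rewrite -e.
have sa' : size a == n by apply/eqP.
set A := (X in \sum_(t \in X) _).
have -> : A = [set Tuple sa']%classic.
  apply/seteqP; split=> t /=.
    by case=> [[_ st _] /(uniq_a _ st) e]; apply: val_inj.
  by move=> ->.
by rewrite fsbig_set1.
Qed.

Lemma reading_trans : transitive reading.
Proof. move=> [x y] [x' y'] [x'' y'']; rewrite /reading /=; lia. Qed.

Lemma reading_total : total reading.
Proof. move=> [x y] [x' y']; rewrite /reading /=; lia. Qed.

Lemma reading_anti : antisymmetric reading.
Proof.
move=> [x y] [x' y']; rewrite /reading /= => h.
by have [-> ->] : x = x' /\ y = y' by lia.
Qed.

(** In the standard filling of a word, [i] is an inverse descent of the reading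
    word iff the cell labelled [i + 1] is read before the cell labelled [i];
    these cells are at positions [i] and [i - 1] of [cs]. *)
Lemma mem_iDes_rw la u i :
    let cs := cells (top_row la) u in
  (i \in iDes (rw (fill cs (iota 1 (size u))))) =
  (1 <= i < size u)%N && ~~ reading (nth (0%N, 0) cs i.-1) (nth (0%N, 0) cs i).
Proof.
move=> cs; set phi := fill _ _; set n := size u.
have scs : size cs = n by rewrite size_cells.
have ucs : uniq cs by apply: cells_uniq.
have pe := perm_enum_domf ucs (mem_fill cs (iota 1 n)).
set S := sort reading (enum_fset (domf phi)).
have pS : perm_eq S cs by rewrite /S perm_sort.
have uS : uniq S by rewrite (perm_uniq pS).
have sS : sorted reading S by apply: sort_sorted reading_total _.
have lcs : map (label phi) cs = iota 1 n by apply: map_label_fill; rewrite ?size_iota.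
have pw : perm_eq (rw phi) (iota 1 n) by rewrite -lcs; apply: perm_map.
have sw : size (rw phi) = n by rewrite (perm_size pw) size_iota.
have uw : uniq (rw phi) by rewrite (perm_uniq pw) iota_uniq.
have idx k : (k < n)%N -> index k.+1 (rw phi) = index (nth (0%N, 0) cs k) S.
  move=> hk; set c := nth _ cs k.
  have cS : c \in S by rewrite (perm_mem pS) mem_nth ?scs.
  have -> : k.+1 = label phi c.
    by rewrite /c -(nth_map _ 0%N) ?scs // lcs nth_iota.
  rewrite -[in LHS](nth_index (0%N, 0) cS) -(nth_map _ 0%N) ?index_mem //.
  by rewrite index_uniq // size_map index_mem.
rewrite /iDes /Des !inE mem_iota /inverse_word size_map size_iota sw.
case: (boolP (1 <= i < n)%N) => hi; last by rewrite andbC; lia.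
have hi1 : (i.-1 < n)%N by lia.
have hi2 : (i < n)%N by lia.
have -> : (1 <= i < 1 + n.-1)%N by lia.
rewrite !(nth_map 0%N) ?size_iota // !nth_iota // !add1n ltnS !idx //.
have cS k : (k < n)%N -> nth (0%N, 0) cs k \in S.
  by move=> hk; rewrite (perm_mem pS) mem_nth ?scs.
rewrite ltnNge /=; congr (~~ _); apply/idP/idP.
  apply: (sorted_leq_index reading_trans _ sS); rewrite ?cS //.
  by move=> x; have := reading_total x x; rewrite orbb.
apply: contraTT; rewrite -ltnNge => lt.
have r := sorted_ltn_index reading_trans sS _ _ (cS _ hi2) (cS _ hi1) lt.
apply/negP=> r'; have e : nth (0%N, 0) cs i = nth (0%N, 0) cs i.-1.
  by apply: reading_anti; rewrite r r'.
by move: lt; rewrite e ltnn.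
Qed.

Lemma canonical_standard rho la s n u : size u = n ->
  canonical rho la s (iota 1 n) u = covers s (top_row la) u.
Proof.
move=> su; rewrite /canonical; case: covers => //=.
apply/(sortedP (0%N, (0%N, 0))) => i; rewrite size_zip size_iota size_cells su.
rewrite minnn => hi; rewrite !nth_zip ?size_iota ?size_cells //=.
by rewrite /cell_tie /= !nth_iota ?(ltnW hi) //; lia.
Qed.

Lemma cell_tie_id x y (c c' : cell) :
  cell_tie id (x, c) (y, c') = (x == y) ==> reading c c'.
Proof. by []. Qed.

(** For a word [u] that fills all cells in positive rows, the sequence [a]
    satisfies the strictness conditions of the fundamental quasisymmetric
    function of the standard filling of [u] exactly when [u] lists the cells of
    equal labels in reading order. *)
Lemma strict_iDes_rw la s a u : sorted leq a -> size u = size a ->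
  `[< {in iDes (rw (fill (cells (top_row la) u) (iota 1 (size u)))),
        forall i, (nth 0%N a i.-1 < nth 0%N a i)%N} >] && covers s (top_row la) u =
  canonical id la s a u.
Proof.
move=> a_sorted su; rewrite /canonical andbC; congr (_ && _).
apply/asboolP/(sortedP (0%N, (0%N, 0))) => H i.
  rewrite size_zip size_cells su minnn => hi.
  rewrite !nth_zip ?size_cells // cell_tie_id.
  have := H i.+1; rewrite mem_iDes_rw su hi /=.
  case: reading => /=; first by rewrite implybT => _.
  by move=> /(_ isT); lia.
rewrite mem_iDes_rw => /andP[/andP[i_gt0 hi] nr].
have := H i.-1; rewrite size_zip size_cells -su minnn prednK // => /(_ hi).
rewrite !nth_zip ?size_cells // cell_tie_id (negbTE nr) implybF => ne.
have := (sortedP 0%N a_sorted) i.-1; rewrite -su prednK // => /(_ hi).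
by rewrite leq_eqVlt (negbTE ne).
Qed.

Lemma SECI_F_words n la s stat a :
    size a = n -> sorted leq a -> all (leq 1) a ->
  SECI_F_series n la s stat (seq_mset a) =
  \sum_(u <- words s n | canonical id la s a u)
     'X^(stat (fill (cells (top_row la) u) (iota 1 n))).
Proof.
move=> sa a_sorted a_gt0; rewrite /SECI_F_series.
rewrite (@sum_fillings_words _ id la s (iota 1 n)) //; first last.
- move=> phi; rewrite size_iota /SECI /= /xmon; split=> -[h1 h2]; split=> //.
    by apply/eq_seq_msetP.
  exact/eq_seq_msetP.
- by apply/allP=> i; rewrite mem_iota => /andP[].
- exact: iota_sorted.
rewrite size_iota big_seq_cond [RHS]big_seq_cond.
rewrite big_mkcond [RHS]big_mkcond; apply: eq_bigr => u _.
rewrite mem_words; case: eqP => //= su; case: (all _ _) => //=.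
rewrite canonical_standard // gessel_F_eval // -(strict_iDes_rw _ _ a_sorted) ?sa // su.
by case: asboolP => _; case: covers; rewrite ?mulr1 ?mulr0.
Qed.

Lemma ECI_words rho n la s stat a :
    (forall j j' : int, j <= j' -> rho j <= rho j') ->
    size a = n -> sorted leq a -> all (leq 1) a ->
  ECI_series n la s stat (seq_mset a) =
  \sum_(u <- words s n | canonical rho la s a u)
     'X^(stat (fill (cells (top_row la) u) a)).
Proof.
move=> rho_mono <- a_sorted a_gt0.
by rewrite /ECI_series /formal_sum (@sum_fillings_words _ rho la s a).
Qed.

(** Monomials of the wrong degree, or involving the index 0, occur in none of the
    series. *)
Lemma series_degenerate n la s stat (m : monomial) :
    ~~ ((size (enum_mset m) == n) && all (leq 1) (enum_mset m)) ->
  ECI_series n la s stat m = 0 /\ SECI_F_series n la s stat m = 0.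
Proof.
move=> bad; split.
  apply: fsbig1 => phi [/ECI_labels[s1 s2] e]; move: bad; rewrite -e.
  rewrite /xmon (perm_size (perm_eq_seq_mset _)) s1 eqxx.
  by rewrite (perm_all _ (perm_eq_seq_mset _)) s2.
apply: fsbig1 => phi _; rewrite /gessel_F /formal_sum fsbig1 ?mulr0 // => t [[p _ _] e].
move: bad; rewrite -e (perm_size (perm_eq_seq_mset _)) size_tuple eqxx.
by rewrite (perm_all _ (perm_eq_seq_mset _)) p.
Qed.

(** * The four series *)

Lemma id_mono (j j' : int) : j <= j' -> id j <= id j'.
Proof. by []. Qed.

Lemma trunc_mono (j j' : int) : j <= j' -> trunc j <= trunc j'.
Proof. rewrite /trunc; lia. Qed.

Lemma id_lt (j : int) : 0 <= j -> id j < id (j + 1).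
Proof. rewrite /=; lia. Qed.

Lemma trunc_lt (j : int) : 0 <= j -> trunc j < trunc (j + 1).
Proof. rewrite /trunc; lia. Qed.

Section Series.

Variables (n : nat) (la : seq nat) (s : nat) (a : seq nat).
Hypotheses (sa : size a = n) (a_sorted : sorted leq a) (a_gt0 : all (leq 1) a).

Lemma ECI_dinv_words : ECI_series n la s (dinv la s) (seq_mset a) =
  \sum_(u <- words s n | canonical id la s a u)
     'X^(sumn (weights id s (top_row la) u)).
Proof.
rewrite (ECI_words _ _ _ id_mono) // big_seq_cond [RHS]big_seq_cond.
by apply: eq_bigr => u /andP[hu gu]; rewrite dinv_fill // sa.
Qed.

Lemma SECI_dinv_words : SECI_F_series n la s (dinv la s) (seq_mset a) =
  \sum_(u <- words s n | canonical id la s a u)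
     'X^(sumn (weights id s (top_row la) u)).
Proof.
rewrite SECI_F_words // big_seq_cond [RHS]big_seq_cond.
apply: eq_bigr => u /andP[hu gu]; rewrite dinv_fill ?size_iota ?iota_sorted //.
rewrite canonical_standard; first by case/andP: gu.
by move: hu; rewrite mem_words => /andP[/eqP].
Qed.

(** For inv, the canonical words may be taken in reading order or in the order
    that identifies all basement rows. The former serves for the quasisymmetric
    expansion and the latter for the comparison with dinv. *)
Lemma ECI_inv_words rho : (forall j j' : int, j <= j' -> rho j <= rho j') ->
    (forall j : int, 0 <= j -> rho j < rho (j + 1)) ->
  ECI_series n la s (inv la s) (seq_mset a) =
  \sum_(u <- words s n | canonical rho la s a u)
     'X^(sumn (weights trunc s (top_row la) u)).
Proof.
move=> r1 r2; rewrite (ECI_words _ _ _ r1) // big_seq_cond [RHS]big_seq_cond.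
by apply: eq_bigr => u /andP[hu gu]; rewrite (inv_fill _ _ r1 r2) // sa.
Qed.

Lemma SECI_inv_words : SECI_F_series n la s (inv la s) (seq_mset a) =
  \sum_(u <- words s n | canonical id la s a u)
     'X^(sumn (weights trunc s (top_row la) u)).
Proof.
rewrite SECI_F_words // big_seq_cond [RHS]big_seq_cond.
apply: eq_bigr => u /andP[hu gu].
rewrite (inv_fill _ _ id_mono id_lt) ?size_iota ?iota_sorted //.
rewrite canonical_standard; first by case/andP: gu.
by move: hu; rewrite mem_words => /andP[/eqP].
Qed.

Lemma ECI_inv_dinv :
  ECI_series n la s (inv la s) (seq_mset a) =
  ECI_series n la s (dinv la s) (seq_mset a).
Proof.
rewrite (ECI_inv_words trunc_mono trunc_lt) ECI_dinv_words -sa.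
rewrite [LHS]big_seq_cond [RHS]big_seq_cond.
under eq_bigl => u do rewrite (andb_id2l (canonical_weights _ trunc_mono)).
under [RHS]eq_bigl => u do rewrite (andb_id2l (canonical_weights _ id_mono)).
(* With initial weight 0 the path condition holds at the first letter. *)
rewrite -!big_seq_cond; case: a => [|x b].
  by rewrite /= !big_cons !big_nil.
have sorted_path (w : seq nat) :
    sorted tie (zip (x :: b) w) = path tie (x, 0%N) (zip (x :: b) w).
  by case: w => [|y w] //=; rewrite /tie /= implybT.
under eq_bigl => u do rewrite sorted_path.
under [RHS]eq_bigl => u do rewrite sorted_path.
by symmetry; apply: sum_words_trunc.
Qed.

End Series.

Theorem corollary5p11 (k n s : nat) (la : seq nat)
    (k_gt0 : (0 < k)%N) (s_gt0 : (0 < s)%N) (le_kn : (k <= n)%N)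
    (la_part : is_partition_of k la) (la_size : (size la <= s)%N) :
  [/\ Dseries n la s = ECI_series n la s (dinv la s),
      Dseries n la s = SECI_F_series n la s (inv la s) &
      SECI_F_series n la s (inv la s) = SECI_F_series n la s (dinv la s)].
Proof.
have key (m : monomial) :
  [/\ Dseries n la s m = ECI_series n la s (dinv la s) m,
      Dseries n la s m = SECI_F_series n la s (inv la s) m &
      SECI_F_series n la s (dinv la s) m = ECI_series n la s (dinv la s) m].
  have [/andP[/eqP sm m_gt0]|bad] :=
      boolP ((size (enum_mset m) == n) && all (leq 1) (enum_mset m)).
    set a := sort leq (enum_mset m).
    have pa : perm_eq a (enum_mset m) by rewrite /a perm_sort.
    have -> : m = seq_mset a.
      by rewrite -[LHS]seq_mset_id; apply/eq_seq_msetP; rewrite perm_sym.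
    have sa : size a = n by rewrite (perm_size pa).
    have a_sorted : sorted leq a by apply: sort_sorted leq_total _.
    have a_gt0 : all (leq 1) a by rewrite (perm_all _ pa).
    split; rewrite /Dseries.
    - exact: ECI_inv_dinv.
    - by rewrite SECI_inv_words // (ECI_inv_words la s sa a_sorted a_gt0 id_mono id_lt).
    - by rewrite SECI_dinv_words // ECI_dinv_words.
  have [e1 e2] := series_degenerate la s (inv la s) bad.
  have [e3 e4] := series_degenerate la s (dinv la s) bad.
  by rewrite /Dseries e1 e2 e3 e4.
split; apply: funext => m; have [e1 e2 e3] := key m => //.
by rewrite -e2 e1 e3.
Qed.
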